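(* Let $A$ and $B$ be two associative algebras and $(\vartriangleright,\vartriangleleft,\theta)$ a non-abelian $2$-cocycle on $A$ with values in $B$. Let $r:B\to A$ be a $(\vartriangleright,\vartriangleleft,\theta)$-twisted Rota-Baxter operator. Then $(B,\prec_r,\succ_r,\curlyvee_r,\cdot_B)$ is a twisted tridendriform algebra, where for $x,y\in B$ $$x\prec_r y:=x\vartriangleleft r(y),\qquad x\succ_r y:=r(x)\vartriangleright y,\qquad x\curlyvee_r y:=\theta(r(x),r(y)).$$
   Context: All vector spaces are over a fixed field; associative algebras $(A,\cdot_A)$, $(B,\cdot_B)$ are not assumed unital. A non-abelian $2$-cocycle on $A$ with values in $B$ is a triple of bilinear maps $\vartriangleright:A\times B\to B$, $\vartriangleleft:B\times A\to B$, $\theta:A\times A\to B$ such that for all $a,b,c\in A$, $x,y\in B$: $(a\cdot_A b)\vartriangleright x+\theta(a,b)\cdot_B x=a\vartriangleright(b\vartriangleright x)$; $(a\vartriangleright x)\vartriangleleft b=a\vartriangleright(x\vartriangleleft b)$; $(x\vartriangleleft a)\vartriangleleft b=x\vartriangleleft(a\cdot_A b)+x\cdot_B\theta(a,b)$; $(a\vartriangleright x)\cdot_B y=a\vartriangleright(x\cdot_B y)$; $(x\vartriangleleft a)\cdot_B y=x\cdot_B(a\vartriangleright y)$; $(x\cdot_B y)\vartriangleleft a=x\cdot_B(y\vartriangleleft a)$; $\theta(a,b)\vartriangleleft c+\theta(a\cdot_A b,c)=a\vartriangleright\theta(b,c)+\theta(a,b\cdot_A c)$. A $(\vartriangleright,\vartriangleleft,\theta)$-twisted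 Rota-Baxter operator is a linear map $r:B\to A$ with $r(x)\cdot_A r(y)=r\big(r(x)\vartriangleright y+x\vartriangleleft r(y)+x\cdot_B y+\theta(r(x),r(y))\big)$ for all $x,y\in B$. A twisted tridendriform algebra is a tuple $(\mathcal A,\prec,\succ,\curlyvee,\cdot)$ of a vector space with four bilinear operations such that, with $x\star y:=x\prec y+x\succ y+x\curlyvee y+x\cdot y$, for all $x,y,z\in\mathcal A$: $(x\prec y)\prec z=x\prec(y\star z)+x\cdot(y\curlyvee z)$; $(x\succ y)\prec z=x\succ(y\prec z)$; $(x\star y)\succ z+(x\curlyvee y)\cdot z=x\succ(y\succ z)$; $(x\succ y)\cdot z=x\succ(y\cdot z)$; $(x\prec y)\cdot z=x\cdot(y\succ z)$; $(x\cdot y)\prec z=x\cdot(y\prec z)$; $(x\cdot y)\cdot z=x\cdot(y\cdot z)$; $(x\curlyvee y)\prec z+(x\star y)\curlyvee z=x\succ(y\curlyvee z)+x\curlyvee(y\star z)$. *)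

(* Defs.v *)
From mathcomp Require Import all_boot all_algebra.

Set Implicit Arguments.
Unset Strict Implicit.
Unset Printing Implicit Defensive.

Import GRing.Theory.
Local Open Scope ring_scope.

(* MathComp's algebra structures are all unital, so a not necessarily unital   *)
(* associative algebra is an lmodType V with a product mul : V -> V -> V such  *)
(* that [assoc_algebra mul] holds.  Operations are plain functions, whose      *)
(* bilinearity is part of each predicate below.                                *)

Definition bilinear_map (K : fieldType) (U V W : lmodType K)
    (f : U -> V -> W) : Prop :=
  bilinear_for *:%R *:%R f.

Record assoc_algebra (K : fieldType) (V : lmodType K)
    (mul : V -> V -> V) : Prop := AssocAlgebra {
  assoc_algebra_bilinear : bilinear_map mul;
  assoc_algebra_assoc : associative mul
}.

Section NonAbelianCocycle.

Variables (K : fieldType) (A B : lmodType K).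
Variables (mulA : A -> A -> A) (mulB : B -> B -> B).
Variables (lact : A -> B -> B) (ract : B -> A -> B) (theta : A -> A -> B).

Local Notation "a *A b" := (mulA a b) (at level 40, left associativity).
Local Notation "x *B y" := (mulB x y) (at level 40, left associativity).
Local Notation "a |> x" := (lact a x) (at level 40, left associativity).
Local Notation "x <| a" := (ract x a) (at level 40, left associativity).

Record nonabelian_2cocycle : Prop := NonAbelian2Cocycle {
  cocycle_lact_bilinear : bilinear_map lact;
  cocycle_ract_bilinear : bilinear_map ract;
  cocycle_theta_bilinear : bilinear_map theta;
  cocycle_lact_lact : forall a b x,
    ((a *A b) |> x) + (theta a b *B x) = a |> (b |> x);
  cocycle_lact_ract : forall a b x,
    (a |> x) <| b = a |> (x <| b);
  cocycle_ract_ract : forall a b x,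
    (x <| a) <| b = (x <| (a *A b)) + (x *B theta a b);
  cocycle_lact_mul : forall a x y,
    (a |> x) *B y = a |> (x *B y);
  cocycle_ract_mul : forall a x y,
    (x <| a) *B y = x *B (a |> y);
  cocycle_mul_ract : forall a x y,
    (x *B y) <| a = x *B (y <| a);
  cocycle_theta : forall a b c,
    (theta a b <| c) + theta (a *A b) c = (a |> theta b c) + theta a (b *A c)
}.

Record twisted_Rota_Baxter (r : B -> A) : Prop := TwistedRotaBaxter {
  twisted_Rota_Baxter_linear : linear r;
  twisted_Rota_BaxterE : forall x y,
    r x *A r y =
    r ((r x |> y) + (x <| r y) + (x *B y) + theta (r x) (r y))
}.

End NonAbelianCocycle.

Section TwistedTridendriform.

Variables (K : fieldType) (V : lmodType K).
Variables (prec succ vee dot : V -> V -> V).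

Local Notation "x -< y" := (prec x y) (at level 40, left associativity).
Local Notation "x >- y" := (succ x y) (at level 40, left associativity).
Local Notation "x \Y/ y" := (vee x y) (at level 40, left associativity).
Local Notation "x <o> y" := (dot x y) (at level 40, left associativity).

Definition tridendriform_star (x y : V) : V :=
  (x -< y) + (x >- y) + (x \Y/ y) + (x <o> y).

Local Notation "x <*> y" := (tridendriform_star x y)
  (at level 40, left associativity).

Record twisted_tridendriform : Prop := TwistedTridendriform {
  tridend_prec_bilinear : bilinear_map prec;
  tridend_succ_bilinear : bilinear_map succ;
  tridend_vee_bilinear : bilinear_map vee;
  tridend_dot_bilinear : bilinear_map dot;
  tridend_prec_prec : forall x y z,
    (x -< y) -< z = (x -< (y <*> z)) + (x <o> (y \Y/ z));
  tridend_succ_prec : forall x y z,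
    (x >- y) -< z = x >- (y -< z);
  tridend_succ_succ : forall x y z,
    ((x <*> y) >- z) + ((x \Y/ y) <o> z) = x >- (y >- z);
  tridend_succ_dot : forall x y z,
    (x >- y) <o> z = x >- (y <o> z);
  tridend_prec_dot : forall x y z,
    (x -< y) <o> z = x <o> (y >- z);
  tridend_dot_prec : forall x y z,
    (x <o> y) -< z = x <o> (y -< z);
  tridend_dot_dot : forall x y z,
    (x <o> y) <o> z = x <o> (y <o> z);
  tridend_vee : forall x y z,
    ((x \Y/ y) -< z) + ((x <*> y) \Y/ z) =
    (x >- (y \Y/ z)) + (x \Y/ (y <*> z))
}.

End TwistedTridendriform.

(* Main.v *)
Require Import Defs.
From mathcomp Require Import all_boot all_algebra.

(** The defining identity of a twisted Rota-Baxter operator says exactly that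
    [r] carries the total product [star] of the four operations on [B] to the
    product of [A] ([twisted_Rota_Baxter_star]).  Under this substitution each
    identity of a twisted tridendriform algebra becomes one of the 2-cocycle
    identities, with [r] applied to every variable in an [A]-slot, except the
    associativity of the dot operation, which is that of [B].  Bilinearity
    survives precomposition with the linear map [r] in either argument. *)

Import GRing.Theory.
Local Open Scope ring_scope.

Lemma bilinear_map_comp {K : fieldType} {U U' V V' W : lmodType K}
    {f : U -> V -> W} {g : U' -> U} {h : V' -> V} :
  bilinear_map f -> linear g -> linear h ->
  bilinear_map (fun x y => f (g x) (h y)).
Proof.
move=> [fl fr] g_lin h_lin; split=> [y|x] a u v /=.
  by rewrite g_lin fl.
by rewrite h_lin fr.
Qed.

Lemma twisted_Rota_Baxter_star {K : fieldType} {A B : lmodType K}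
    {mulA : A -> A -> A} {mulB : B -> B -> B}
    {lact : A -> B -> B} {ract : B -> A -> B} {theta : A -> A -> B}
    {r : B -> A} :
  twisted_Rota_Baxter mulA mulB lact ract theta r ->
  forall x y,
    r (tridendriform_star (fun x y => ract x (r y)) (fun x y => lact (r x) y)
         (fun x y => theta (r x) (r y)) mulB x y) = mulA (r x) (r y).
Proof.
move=> [_ rE] x y; rewrite rE /tridendriform_star.
by rewrite (addrC (ract _ _)) addrAC.
Qed.

Theorem proposition8p5 (K : fieldType) (A B : lmodType K)
    (mulA : A -> A -> A) (mulB : B -> B -> B)
    (lact : A -> B -> B) (ract : B -> A -> B) (theta : A -> A -> B)
    (r : B -> A)
    (hA : assoc_algebra mulA) (hB : assoc_algebra mulB)
    (hcocycle : nonabelian_2cocycle mulA mulB lact ract theta)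
    (hr : twisted_Rota_Baxter mulA mulB lact ract theta r) :
  twisted_tridendriform
    (fun x y : B => ract x (r y))
    (fun x y : B => lact (r x) y)
    (fun x y : B => theta (r x) (r y))
    mulB.
Proof.
have r_star := twisted_Rota_Baxter_star hr.
have r_lin := twisted_Rota_Baxter_linear hr.
have id_lin : linear (@id B) by [].
case: hB => mulB_bilin mulBA.
case: hcocycle => lact_bilin ract_bilin theta_bilin lactA lract ractA
  lactM ractM Mract thetaE.
split=> [||||x y z|x y z|x y z|x y z|x y z|x y z|x y z|x y z].
- exact: (bilinear_map_comp ract_bilin id_lin r_lin).
- exact: (bilinear_map_comp lact_bilin r_lin id_lin).
- exact: (bilinear_map_comp theta_bilin r_lin r_lin).
- exact: mulB_bilin.
- by rewrite r_star ractA.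
- exact: lract.
- by rewrite r_star lactA.
- exact: lactM.
- exact: ractM.
- exact: Mract.
- by rewrite mulBA.
- by rewrite !r_star thetaE.
Qed.
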